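(* Consider a $2\times 2$ contingency table with positive cell counts and observed cell proportions $\tilde p_{kl}$ ($k,l\in\{1,2\}$), with row marginals $\tilde p_{k+}=\tilde p_{k1}+\tilde p_{k2}$ and column marginals $\tilde p_{+l}=\tilde p_{1l}+\tilde p_{2l}$. Let $\widehat\mu_1$ be the (plug-in) estimate of the parameter $\mu_1$ of the maximum-entropy LP-copula model $$c_{\mu}(u,v;X,Y)=e^{\mu_0+\mu_1\phi_1(u;X)\psi_1(v;Y)} ,$$ as defined in the context. Then $$\widehat\mu_1=\log\left[\frac{\tilde p_{11}\,\tilde p_{22}}{\tilde p_{12}\,\tilde p_{21}}\right]\bigl(\tilde p_{1+}\,\tilde p_{+1}\,\tilde p_{2+}\,\tilde p_{+2}\bigr)^{1/2},$$ where the quantity in square brackets is the sample odds-ratio (so its logarithm is the sample log-odds-ratio).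
   Context: $X$ and $Y$ are binary with values in $\{0,1\}$; row $1$ (resp. column $1$) of the table corresponds to $X=0$ (resp. $Y=0$) and row $2$ (resp. column $2$) to $X=1$ (resp. $Y=1$). If $f_{kl}>0$ are the cell counts and $n=\sum_{k,l}f_{kl}$, then $\tilde p_{kl}=f_{kl}/n$. For cell probabilities $p_{kl}$ with marginals $p_{k+},p_{+l}$, the row and column score functions are $$\phi_1(F_X(x))=\frac{x-p_{2+}}{\sqrt{p_{1+}p_{2+}}},\qquad \psi_1(F_Y(y))=\frac{y-p_{+2}}{\sqrt{p_{+1}p_{+2}}},\qquad x,y\in\{0,1\}.$$ Write $\phi_{1k}$ for the value of $\phi_1$ at row $k$ (so $x=k-1$) and $\psi_{1l}$ for the value of $\psi_1$ at column $l$ (so $y=l-1$). The intrinsic association parameter $\mu_1$ of the model is given by $$\mu_1=\sum_{k=1}^{2}\sum_{l=1}^{2}(\log p_{kl})\,p_{k+}\,p_{+l}\,\phi_{1k}\,\psi_{1l}.$$ Its estimate $\widehat\mu_1$ is obtained by replacing all $p_{kl},p_{k+},p_{+l}$ in this formula (including in the scores) by $\tilde p_{kl},\tilde p_{k+},\tilde p_{+l}$. *)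

(* Defs.v *)
From mathcomp Require Import all_boot all_order all_algebra.
From mathcomp Require Import all_classical all_reals all_analysis.
Set Implicit Arguments.
Unset Strict Implicit.
Unset Printing Implicit Defensive.
Import Order.TTheory GRing.Theory Num.Theory.
Local Open Scope ring_scope.

(** A 2x2 table is a 2x2 matrix, with 0-based indices: the mathematical row
    (column) number k is the ordinal k - 1, so the value of X (of Y) on a row
    (column) is the ordinal itself, read as a number. *)

Definition row_marg (R : realType) (p : 'M[R]_2) (k : 'I_2) : R :=
  \sum_(l < 2) p k l.

Definition col_marg (R : realType) (p : 'M[R]_2) (l : 'I_2) : R :=
  \sum_(k < 2) p k l.

(** [row_score p x] is phi_1(F_X(x)) and [col_score p y] is psi_1(F_Y(y)). *)
Definition row_score (R : realType) (p : 'M[R]_2) (x : R) : R :=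
  (x - row_marg p 1) / Num.sqrt (row_marg p 0 * row_marg p 1).

Definition col_score (R : realType) (p : 'M[R]_2) (y : R) : R :=
  (y - col_marg p 1) / Num.sqrt (col_marg p 0 * col_marg p 1).

(** The parameter mu_1 of the LP-copula model
    c(u, v) = exp (mu_0 + mu_1 * phi_1 u * psi_1 v).  When
    p_kl = p_k+ * p_+l * c (F_X (k-1), F_Y (l-1)), expanding log p_kl and using
    that the scores have mean 0 and variance 1 under the marginals, the sum
    below is the exponent's mu_1. *)
Definition mu1 (R : realType) (p : 'M[R]_2) : R :=
  \sum_(k < 2) \sum_(l < 2)
    ln (p k l) * row_marg p k * col_marg p l
      * row_score p k%:R * col_score p l%:R.

Definition table_total (f : 'M[nat]_2) : nat :=
  (\sum_(k < 2) \sum_(l < 2) f k l)%N.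

Definition cell_prop (R : realType) (f : 'M[nat]_2) : 'M[R]_2 :=
  \matrix_(k, l) ((f k l)%:R / (table_total f)%:R).

Definition mu1_hat (R : realType) (f : 'M[nat]_2) : R := mu1 (cell_prop R f).

Definition odds_ratio (R : realType) (p : 'M[R]_2) : R :=
  (p 0 0 * p 1 1) / (p 0 1 * p 1 0).

(* Main.v *)
(** For a binary variable with marginal probabilities [q0 + q1 = 1], weighting
    the score by the marginal gives [- s] at 0 and [s] at 1, where
    [s = sqrt (q0 * q1)].  Hence each cell of the sum defining mu_1 contributes
    plus or minus [ln p_kl], times the common product of the row and column
    values of [s], and the signs are those of the log-odds-ratio. *)
Require Import Defs.
From mathcomp Require Import all_boot all_order all_algebra.
From mathcomp Require Import all_classical all_reals all_analysis.
From mathcomp Require Import ring.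
Import Order.TTheory GRing.Theory Num.Theory.
Local Open Scope ring_scope.

(** Puts the second index in the literal form [1], in which the marginals, scores and odds ratio are
    written, instead of a [lift]. *)
Lemma big_ord2 (V : nmodType) (F : 'I_2 -> V) :
  \sum_(i < 2) F i = F 0 + F 1.
Proof.
by rewrite big_ord_recl big_ord1; congr (_ + F _); apply/val_inj.
Qed.

Lemma weighted_score0 (R : rcfType) (q0 q1 : R) :
  0 < q0 -> 0 < q1 -> q0 * ((0 - q1) / Num.sqrt (q0 * q1)) = - Num.sqrt (q0 * q1).
Proof.
move=> q0_gt0 q1_gt0; have q_gt0 : 0 < q0 * q1 by rewrite mulr_gt0.
have s_neq0 : Num.sqrt (q0 * q1) != 0 by rewrite gt_eqF ?sqrtr_gt0.
(* Multiplied by the root, both sides become [- (q0 * q1)]. *)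
apply: (mulIf s_neq0).
by rewrite sub0r mulrA divfK // mulrN mulNr -expr2 sqr_sqrtr ?ltW.
Qed.

Lemma weighted_score1 (R : rcfType) (q0 q1 : R) :
  0 < q0 -> 0 < q1 -> q0 + q1 = 1 ->
  q1 * ((1 - q1) / Num.sqrt (q0 * q1)) = Num.sqrt (q0 * q1).
Proof.
(* Writing [1] as [q0 + q1] collapses the numerator [1 - q1] to [q0]. *)
move=> q0_gt0 q1_gt0 <-; have q_gt0 : 0 < q0 * q1 by rewrite mulr_gt0.
have s_neq0 : Num.sqrt (q0 * q1) != 0 by rewrite gt_eqF ?sqrtr_gt0.
apply: (mulIf s_neq0).
by rewrite addrK mulrA divfK // -expr2 sqr_sqrtr ?ltW // mulrC.
Qed.

Lemma ln_odds_ratio (R : realType) (p : 'M[R]_2) :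
  (forall k l, 0 < p k l) ->
  ln (odds_ratio p) = ln (p 0 0) - ln (p 0 1) - ln (p 1 0) + ln (p 1 1).
Proof.
move=> p_gt0; rewrite /odds_ratio.
rewrite ln_div ?posrE ?mulr_gt0 // !lnM ?posrE //; ring.
Qed.

(** Purely algebraic in the cell probabilities; the estimate is the instance at the observed
    proportions. *)
Lemma mu1_ln_odds_ratio (R : realType) (p : 'M[R]_2) :
  (forall k l, 0 < p k l) -> \sum_k \sum_l p k l = 1 ->
  mu1 p = ln (odds_ratio p)
    * Num.sqrt (row_marg p 0 * col_marg p 0 * row_marg p 1 * col_marg p 1).
Proof.
move=> p_gt0 p_sum1.
have row_gt0 k : 0 < row_marg p k by rewrite /row_marg big_ord2 addr_gt0.
have col_gt0 l : 0 < col_marg p l by rewrite /col_marg big_ord2 addr_gt0.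
have row_sum1 : row_marg p 0 + row_marg p 1 = 1 by rewrite -big_ord2.
have col_sum1 : col_marg p 0 + col_marg p 1 = 1.
  by rewrite -big_ord2 -p_sum1 exchange_big.
pose sr := Num.sqrt (row_marg p 0 * row_marg p 1).
pose sc := Num.sqrt (col_marg p 0 * col_marg p 1).
have row0 : row_marg p 0 * row_score p 0 = - sr by exact: weighted_score0.
have row1 : row_marg p 1 * row_score p 1 = sr by exact: weighted_score1.
have col0 : col_marg p 0 * col_score p 0 = - sc by exact: weighted_score0.
have col1 : col_marg p 1 * col_score p 1 = sc by exact: weighted_score1.
(* Row and column marginals alternate under this root; grouping them by variable lets it split. *)
have -> : Num.sqrt (row_marg p 0 * col_marg p 0 * row_marg p 1 * col_marg p 1)
          = sr * sc.
  by rewrite -sqrtrM ?mulr_ge0 ?ltW // mulrACA !mulrA.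
(* Pairs each score with its own marginal, so that the four weighted scores apply in every cell. *)
have cellE (x r c y z : R) : x * r * c * y * z = x * (r * y) * (c * z) by ring.
rewrite ln_odds_ratio // /mu1 !big_ord2 /= !cellE row0 row1 col0 col1; ring.
Qed.

Lemma cell_prop_gt0 (R : realType) (f : 'M[nat]_2) (k l : 'I_2) :
  (0 < f k l)%N -> 0 < cell_prop R f k l.
Proof.
move=> f_gt0; rewrite mxE divr_gt0 ?ltr0n //.
(* The total is positive since [f k l] is one of its summands. *)
by rewrite /table_total (bigD1 k) //= (bigD1 l) //= -addnA ltn_addr.
Qed.

(** A zero total must be excluded: division by zero returns 0, so the proportions would sum to 0. *)
Lemma sum_cell_prop (R : realType) (f : 'M[nat]_2) :
  (0 < table_total f)%N -> \sum_k \sum_l cell_prop R f k l = 1.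
Proof.
move=> total_gt0.
under eq_bigr do under eq_bigr do rewrite mxE.
under eq_bigr do rewrite -mulr_suml -natr_sum.
by rewrite -mulr_suml -natr_sum divff // pnatr_eq0 -lt0n.
Qed.

Theorem theorem1 (R : realType) (f : 'M[nat]_2)
    (f_gt0 : forall k l : 'I_2, (0 < f k l)%N) :
  let p := cell_prop R f in
  mu1_hat R f =
    ln (odds_ratio p)
      * Num.sqrt (row_marg p 0 * col_marg p 0 * row_marg p 1 * col_marg p 1).
Proof.
apply: mu1_ln_odds_ratio => [k l|]; first exact: cell_prop_gt0.
by apply: sum_cell_prop; rewrite /table_total !big_ord2 ltn_addr // ltn_addr.
Qed.
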